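(* Let $(X,\mathcal M,\mu)$ be a measure space with a non-trivial $\sigma$-finite measure $\mu$, let $n:X\times\mathbb R\to\mathbb R$ be measurable, and suppose there are a constant $\beta\in[1,\infty)$ and a measurable function $\phi:X\to\mathbb R$ such that $$|n(x,y)|\le \phi(x)\,|y|^{\beta}\qquad\text{for all }x\in X,\ y\in\mathbb R.$$ Let $\psi$ and $\nu$ be generating functions, let $g\in G\psi$ and $\phi\in G\nu$ (Grand Lebesgue Spaces over $X$), and let $f$ be the image of $g$ under the Nemytskii operator, $f(x)=N[g](x):=n(x,g(x))$. For $1<r<p<\infty$ put $$W_a(p,r)=\nu\!\left(\frac{pr}{p-r}\right)\psi^{\beta}(\beta p),\qquad W(r)=W[\psi,\nu;\beta](r)=\inf_{p\in(r,\infty)}W_a(p,r).$$ Suppose that $W(r)$ is finite for all $r$ in some non-trivial interval $(c,d)$, $1\le c<d\le\infty$, so that $W$ is a generating function on $(c,d)$. Then $$\|f\|_{GW}\le \|\phi\|_{G\nu}\,\bigl(\|g\|_{G\psi}\bigr)^{\beta},\qquad\text{where } \|f\|_{GW}=\sup_{r\in(c,d)}\frac{\|f\|_{r,X}}{W(r)}.$$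
   Context: All functions are assumed measurable. For a measure space $(V,\mathcal D,\gamma)$ with $\sigma$-finite $\gamma$ and $1\le p<\infty$, $\|f\|_{p,V}=\left(\int_V|f|^p\,d\gamma\right)^{1/p}$. A generating function is a strictly positive, finite-valued function $\psi=\psi(p)$ defined on an interval $(a,b)$ with $1\le a<b\le\infty$, called its support; one sets $\psi(p)=\infty$ for $p\notin(a,b)$. The Grand Lebesgue Space $G\psi$ over $V$ consists of all measurable $f:V\to\mathbb R$ with finite norm $$\|f\|_{G\psi}=\sup_{p\in(a,b)}\frac{\|f\|_{p,V}}{\psi(p)}.$$ Different generating functions may have different supports. $\psi^{\beta}(\beta p)$ means $(\psi(\beta p))^{\beta}$, and a product with an infinite factor is $+\infty$. *)

(* Defs.v *)
From HB Require Import structures.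
From mathcomp Require Import all_boot all_order all_algebra.
From mathcomp Require Import all_classical all_reals all_analysis.
Set Implicit Arguments.
Unset Strict Implicit.
Unset Printing Implicit Defensive.
Import Order.TTheory GRing.Theory Num.Theory.
Import numFieldNormedType.Exports.
Local Open Scope classical_set_scope.
Local Open Scope ring_scope.
Local Open Scope ereal_scope.

(* The open interval (a, b); the right end point b may be +oo. *)
Definition exp_itv (R : realType) (a : R) (b : \bar R) : set R :=
  [set p | a%:E < p%:E /\ p%:E < b].

(* Nontrivial exponent interval: 1 <= a < b <= oo. *)
Definition exp_itv_ok (R : realType) (a : R) (b : \bar R) : Prop :=
  1 <= a%:E /\ a%:E < b.

(* Extended-real values encode the convention psi(p) = oo off the support. *)
Definition generating_function (R : realType) (a : R) (b : \bar R)
    (psi : R -> \bar R) : Prop :=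
  [/\ exp_itv_ok a b,
      forall p, exp_itv a b p -> 0 < psi p /\ psi p < +oo &
      forall p, ~ exp_itv a b p -> psi p = +oo].

(* The library's conventions for division on \bar R (0^-1 = +oo and
   0 * +oo = 0) only matter where psi vanishes: there the quotient is 0 if
   f = 0 almost everywhere, and +oo otherwise. *)
Definition GLS_norm (d : measure_display) (T : measurableType d)
    (R : realType) (mu : {measure set T -> \bar R})
    (a : R) (b : \bar R) (psi : R -> \bar R) (f : T -> R) : \bar R :=
  ereal_sup [set 'N[mu]_(p%:E)[EFin \o f] / psi p | p in exp_itv a b].

Definition in_GLS (d : measure_display) (T : measurableType d)
    (R : realType) (mu : {measure set T -> \bar R})
    (a : R) (b : \bar R) (psi : R -> \bar R) (f : T -> R) : Prop :=
  measurable_fun [set: T] f /\ GLS_norm mu a b psi f < +oo.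

Definition nemytskii (T U V : Type) (n : T * U -> V) (g : T -> U) : T -> V :=
  fun x => n (x, g x).

(* For generating functions both factors are in ]0, +oo], so that the product
   is +oo as soon as one of them is. *)
Definition Wa (R : realType) (psi nu : R -> \bar R) (beta p r : R) : \bar R :=
  nu (p * r / (p - r))%R * psi (beta * p)%R `^ beta.

Definition W (R : realType) (psi nu : R -> \bar R) (beta r : R) : \bar R :=
  ereal_inf [set Wa psi nu beta p r | p in [set p : R | (r < p)%R]].

(* Main.v *)
(* If 1/r = 1/p + 1/q, that is, q = pr/(p-r), Hoelder's inequality gives
   ||f||_r <= ||phi||_q || |g|^beta ||_p = ||phi||_q (||g||_(beta p))^beta.
   Bounding each norm by its Grand Lebesgue norm times the generating function
   yields ||f||_r <= ||phi||_(G nu) (||g||_(G psi))^beta W_a(p, r) whenever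
   W_a(p, r) is finite; then take the infimum over p. When W(r) = 0 this still
   gives ||f||_r = 0, so the quotient 0 * +oo = 0 satisfies the bound. *)

Require Import Defs.
From HB Require Import structures.
From mathcomp Require Import all_boot all_order all_algebra.
From mathcomp Require Import all_classical all_reals all_analysis.
From mathcomp Require Import measurable_realfun ring.
Import Order.TTheory GRing.Theory Num.Theory.
Import numFieldNormedType.Exports.
Local Open Scope classical_set_scope.
Local Open Scope ring_scope.
Local Open Scope ereal_scope.

Section Lnorm_extra.
Context {d : measure_display} {T : measurableType d} {R : realType}.
Variable mu : {measure set T -> \bar R}.
Implicit Types (f g : T -> R) (p q r s : R).

Local Notation "'N_ p [ f ]" := ('N[mu]_(p%:E)[EFin \o f]).

Lemma le_Lnorm f g p : measurable_fun [set: T] f -> measurable_fun [set: T] g ->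
  (0 < p)%R -> (forall x, `|f x| <= `|g x|)%R -> 'N_p[f] <= 'N_p[g].
Proof.
move=> mf mg p0 fg.
have mpow (h : T -> R) : measurable_fun [set: T] h ->
    measurable_fun [set: T] (fun x => `|(h x)%:E| `^ p : \bar R).
  move=> mh; apply: (measurableT_comp (measurable_poweR p)).
  by apply: measurableT_comp => //; exact: measurableT_comp.
have int_ge0 (h : T -> R) : 0 <= \int[mu]_x `|(EFin \o h) x| `^ p.
  by apply: integral_ge0 => x _; exact: poweR_ge0.
rewrite unlock; apply: gt0_ler_poweR.
- by rewrite invr_ge0 ltW.
- by rewrite in_itv/= int_ge0 leey.
- by rewrite in_itv/= int_ge0 leey.
apply: ge0_le_integral => //; [|exact: mpow|exact: mpow|].
- by move=> x _; exact: poweR_ge0.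
- move=> x _; apply: gt0_ler_poweR; rewrite ?in_itv/= ?leey ?lee_fin ?(ltW p0) ?normr_ge0//.
Qed.

(** The outer exponent [p^-1] factors as [(s * p)^-1 * s]. Used with [s = r] to rescale Hoelder's
    inequality, and with [s = beta] to trade [|g|^beta] at exponent [p] for [g] at exponent
    [beta * p]. *)
Lemma Lnorm_norm_powR f s p : s != 0%R -> p != 0%R ->
  'N_p[(fun x => `|f x| `^ s)%R] = 'N_(s * p)[f] `^ s.
Proof.
move=> s0 p0; rewrite unlock -poweRrM invfM mulrAC mulVf// mul1r.
congr (_ `^ _); apply: eq_integral => x _ /=.
by rewrite ger0_norm ?powR_ge0// powRrM.
Qed.

(** Multiplying the relation between exponents by [r] shows that [p / r] and [q / r] are conjugate;
    the classical Hoelder inequality for [|f|^r] and [|g|^r] is then the claim raised to the power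
    [r]. *)
Lemma hoelder_gen f g p q r :
  measurable_fun [set: T] f -> measurable_fun [set: T] g ->
  (0 < p)%R -> (0 < q)%R -> (0 < r)%R -> (p^-1 + q^-1 = r^-1)%R ->
  'N_r[(f \* g)%R] <= 'N_p[f] * 'N_q[g].
Proof.
move=> mf mg p0 q0 r0 pqr.
have r_neq0 : r != 0%R by rewrite gt_eqF.
have mpow (h : T -> R) : measurable_fun [set: T] h ->
    measurable_fun [set: T] (fun x => `|h x| `^ r)%R.
  move=> mh; apply: (@measurableT_comp _ _ _ _ _ _ (@powR R ^~ r)) => //.
  exact: measurableT_comp.
have := @hoelder _ _ _ mu _ _ (p / r)%R (q / r)%R (mpow _ mf) (mpow _ mg).
rewrite !divr_gt0// => /(_ isT isT); rewrite !invf_div -mulrDr.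
rewrite pqr mulfV// => /(_ erefl).
rewrite !Lnorm_norm_powR ?gt_eqF ?divr_gt0//.
rewrite ![(r * (_ / r))%R]mulrC !divfK//.
have -> : ((fun x => `|f x| `^ r) \* (fun x => `|g x| `^ r) =
    (fun x => `|(f \* g) x| `^ r))%R.
  by apply/funext => x /=; rewrite normrM powRM.
rewrite Lnorm_norm_powR ?oner_eq0// mulr1 -poweRM ?Lnorm_ge0// => le_pow.
(* Take [r]-th roots on both sides of [le_pow]. *)
have := gt0_ler_poweR (ltW (_ : 0 < r^-1)%R) _ _ le_pow.
rewrite -!poweRrM mulfV// !poweRe1 ?mule_ge0 ?Lnorm_ge0//.
by apply; rewrite ?invr_gt0// in_itv/= poweR_ge0 leey.
Qed.

End Lnorm_extra.

(** For [k > 0], divide by [k]: infinite members of [S] do not constrain a lower bound. For [k = 0]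
    division fails, and a member below [+oo], which exists because the infimum is below [+oo], gives
    [x <= 0] directly. *)
Lemma le_mul_ereal_inf (R : realType) (S : set (\bar R)) (x : \bar R) (k : R) :
  (0 <= k)%R -> ereal_inf S < +oo ->
  (forall y, S y -> y < +oo -> x <= k%:E * y) -> x <= k%:E * ereal_inf S.
Proof.
rewrite le_eqVlt => /predU1P[<-|k0] infS xS.
  by have [y Sy yy] := ereal_inf_lt infS; have := xS _ Sy yy; rewrite !mul0e.
rewrite -lee_pdivrMl//; apply: le_ereal_inf_tmp => y Sy.
have [yy|] := ltP y +oo; first by rewrite lee_pdivrMl// xS.
by rewrite leye_eq => /eqP ->; exact: leey.
Qed.

Lemma Lnorm_le_GLS_norm (d : measure_display) (T : measurableType d)
    (R : realType) (mu : {measure set T -> \bar R}) (a : R) (b : \bar R)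
    (psi : R -> \bar R) (f : T -> R) (p : R) :
  exp_itv a b p -> 0 < psi p -> psi p < +oo ->
  'N[mu]_(p%:E)[EFin \o f] <= GLS_norm mu a b psi f * psi p.
Proof.
move=> abp psi0 psiy.
have psifin : psi p \is a fin_num by rewrite gt0_fin_numE.
have : 'N[mu]_(p%:E)[EFin \o f] / psi p <= GLS_norm mu a b psi f.
  by apply: ereal_sup_ubound; exists p.
rewrite -(fineK psifin) inver gt_eqF ?fine_gt0 ?psi0//.
by rewrite lee_pdivrMr ?fine_gt0 ?psi0.
Qed.

(** The supremum of the empty set is [-oo], so a point [p] of the interval must be supplied. *)
Lemma GLS_norm_ge0 (d : measure_display) (T : measurableType d)
    (R : realType) (mu : {measure set T -> \bar R}) (a : R) (b : \bar R)
    (psi : R -> \bar R) (f : T -> R) (p : R) :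
  exp_itv a b p -> 0 <= psi p -> 0 <= GLS_norm mu a b psi f.
Proof.
move=> abp psi0; apply: ereal_sup_ge; exists ('N[mu]_(p%:E)[EFin \o f] / psi p).
  by exists p.
by rewrite mule_ge0 ?Lnorm_ge0 ?inve_ge0.
Qed.

Lemma generating_function_gt0 (R : realType) (a : R) (b : \bar R)
    (psi : R -> \bar R) (p : R) : generating_function a b psi -> 0 < psi p.
Proof.
move=> [_ psi_in psi_out]; have [/psi_in[]//|/psi_out ->] := pselect (exp_itv a b p).
exact: ltry.
Qed.

Lemma generating_function_lty (R : realType) (a : R) (b : \bar R)
    (psi : R -> \bar R) (p : R) :
  generating_function a b psi -> psi p < +oo -> exp_itv a b p.
Proof. by move=> [_ _ psi_out]; apply: contraPP => /psi_out ->; rewrite ltxx. Qed.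

Lemma Lnorm_nemytskii_le {R : realType} {d : measure_display}
    {X : measurableType d} (mu : {measure set X -> \bar R}) {n : X * R -> R}
    {beta : R} {phi g : X -> R} {p r : R} :
  measurable_fun [set: X * R] n -> measurable_fun [set: X] phi ->
  measurable_fun [set: X] g -> (0 < beta)%R ->
  (forall x y, `|n (x, y)| <= phi x * `|y| `^ beta)%R -> (0 < r)%R -> (r < p)%R ->
  'N[mu]_(r%:E)[EFin \o nemytskii n g] <=
  'N[mu]_((p * r / (p - r))%:E)[EFin \o phi] *
  'N[mu]_((beta * p)%:E)[EFin \o g] `^ beta.
Proof.
move=> mn mphi mg beta0 n_bound r0 rp.
have p0 : (0 < p)%R by exact: lt_trans rp.
have pr0 : (0 < p - r)%R by rewrite subr_gt0.
have mgb : measurable_fun [set: X] (fun x => `|g x| `^ beta)%R.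
  apply: (@measurableT_comp _ _ _ _ _ _ (@powR R ^~ beta)) => //.
  exact: measurableT_comp.
rewrite -Lnorm_norm_powR ?gt_eqF//.
apply: (@le_trans _ _ 'N[mu]_(r%:E)[EFin \o (phi \* (fun x => `|g x| `^ beta))%R]).
  apply: le_Lnorm => //.
  - by apply: (measurableT_comp mn); exact: measurable_fun_pair.
  - exact: measurable_funM.
  - by move=> x; apply: le_trans (n_bound _ _) (ler_norm _).
apply: hoelder_gen => //; first by rewrite divr_gt0// mulr_gt0.
(* With [q = pr/(p-r)]: [1/q + 1/p = (p-r)/(pr) + r/(pr) = 1/r]. *)
by field; rewrite !gt_eqF.
Qed.

Theorem theorem2p1 (R : realType) (d : measure_display) (X : measurableType d)
    (mu : {sigma_finite_measure set X -> \bar R})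
    (mu_nontrivial : mu [set: X] != 0)
    (n : X * R -> R) (n_meas : measurable_fun [set: X * R] n)
    (beta : R) (beta_ge1 : (1 <= beta)%R)
    (phi : X -> R) (phi_meas : measurable_fun [set: X] phi)
    (n_bound : forall (x : X) (y : R), (`|n (x, y)| <= phi x * `|y| `^ beta)%R)
    (a1 : R) (b1 : \bar R) (psi : R -> \bar R)
    (psi_gen : generating_function a1 b1 psi)
    (a2 : R) (b2 : \bar R) (nu : R -> \bar R)
    (nu_gen : generating_function a2 b2 nu)
    (g : X -> R) (g_in : in_GLS mu a1 b1 psi g)
    (phi_in : in_GLS mu a2 b2 nu phi)
    (c : R) (dd : \bar R) (cd_ok : exp_itv_ok c dd)
    (W_fin : forall r : R, exp_itv c dd r -> W psi nu beta r \is a fin_num) :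
  GLS_norm mu c dd (W psi nu beta) (nemytskii n g) <=
  GLS_norm mu a2 b2 nu phi * (GLS_norm mu a1 b1 psi g) `^ beta.
Proof.
have beta0 : (0 < beta)%R by exact: lt_le_trans beta_ge1.
case: g_in phi_in => mg gfin [_ phifin].
apply: ge_ereal_sup => _ [r cdr <-].
have r0 : (0 < r)%R.
  case: cd_ok cdr => c1 _ [cr _].
  by rewrite -lte_fin (lt_trans _ (le_lt_trans c1 cr))// lte01.
have psi0 p : 0 < psi p by exact: generating_function_gt0 psi_gen.
have nu0 p : 0 < nu p by exact: generating_function_gt0 nu_gen.
(* Both factors of [Wa] are positive, so an infinite one would make the product [+oo]. *)
have Wa_lty p : Wa psi nu beta p r < +oo ->
    nu (p * r / (p - r))%R < +oo /\ psi (beta * p)%R < +oo.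
  move=> Wap; split; rewrite ltey; apply: contraTneq Wap => e.
    by rewrite /Wa e gt0_mulye ?poweR_gt0// ltxx.
  by rewrite /Wa e poweRyr ?gt_eqF// gt0_muley// ltxx.
have Wr_lty : W psi nu beta r < +oo by rewrite ltey_eq W_fin.
have Wr_ge0 : 0 <= W psi nu beta r.
  apply: le_ereal_inf_tmp => _ [p _ <-].
  by rewrite mule_ge0 ?poweR_ge0// ltW.
set A := GLS_norm mu a2 b2 nu phi; set B := GLS_norm mu a1 b1 psi g.
(* Since [W(r)] is below [+oo], some [p] has [Wa] finite there; its two exponents lie in the
   supports of [nu] and [psi], so neither supremum is over the empty set. *)
have [A0 B0] : 0 <= A /\ 0 <= B.
  have [_ [p _ <-] /Wa_lty[nuy psiy]] := ereal_inf_lt Wr_lty.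
  split; (apply: GLS_norm_ge0; last exact: ltW).
    exact: generating_function_lty nu_gen nuy.
  exact: generating_function_lty psi_gen psiy.
have ABfin : A * B `^ beta \is a fin_num.
  by rewrite fin_numM ?fin_num_poweR// ge0_fin_numE.
have AB0 : 0 <= A * B `^ beta by rewrite mule_ge0 ?poweR_ge0.
have NW : 'N[mu]_(r%:E)[EFin \o nemytskii n g] <= A * B `^ beta * W psi nu beta r.
  rewrite -(fineK ABfin); apply: le_mul_ereal_inf => //; first exact: fine_ge0.
  move=> _ [p rp <-] /Wa_lty[nuy psiy]; rewrite (fineK ABfin).
  apply: (le_trans (Lnorm_nemytskii_le mu n_meas phi_meas mg beta0 n_bound r0 rp)).
  (* Regroup the bound as [(A * nu q) * (B * psi (beta * p))^beta] with [q = pr/(p-r)], to compare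
     it factor by factor with the Hoelder bound. *)
  rewrite muleACA -poweRM// ?(ltW (psi0 _))//.
  apply: lee_pmul; rewrite ?poweR_ge0 ?Lnorm_ge0//.
    apply: Lnorm_le_GLS_norm => //; exact: generating_function_lty nu_gen nuy.
  have psi_ge0 : 0 <= psi (beta * p)%R by exact: ltW.
  apply: gt0_ler_poweR; rewrite ?in_itv/= ?leey ?Lnorm_ge0 ?mule_ge0 ?(ltW beta0)//.
  apply: Lnorm_le_GLS_norm => //; exact: generating_function_lty psi_gen psiy.
have [W0|W0] := eqVneq (W psi nu beta r) 0.
  suff -> : 'N[mu]_(r%:E)[EFin \o nemytskii n g] = 0 by rewrite mul0e.
  by apply/eqP; rewrite eq_le Lnorm_ge0 andbT; rewrite W0 mule0 in NW.
have Wfin := W_fin r cdr.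
have W_gt0 : (0 < fine (W psi nu beta r))%R by rewrite fine_gt0// lt0e W0 Wr_ge0.
by rewrite -(fineK Wfin) inver gt_eqF// lee_pdivrMr// fineK.
Qed.
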